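(* Let $(X,m)$ be a probability space and let $T : X\to X$ be an ergodic measurable map preserving $m$. Assume that $T$ is mixing. Let $f : X\to\mathbb{R}$ be a measurable function such that, with respect to $m$, $S_n f/B_n$ converges in distribution to a real random variable $Z$, where $(B_n)$ is a sequence of real numbers with $B_n\to\infty$ and $S_n f = \sum_{k=0}^{n-1} f\circ T^k$. Let $\phi_1,\phi_2 : X\to\mathbb{R}$ be two nonnegative square integrable functions with $\int\phi_1\,\mathrm{d}m = \int\phi_2\,\mathrm{d}m = 1$. Define a sequence of measures $m_n$ on $X$ by $$m_n(U) = \int_U \phi_1\cdot(\phi_2\circ T^n)\,\mathrm{d}m$$ for measurable $U\subseteq X$. They satisfy $m_n(X)\to 1$ as $n\to\infty$. Then the random variables $S_n f/B_n$ on the probability spaces $(X, m_n/m_n(X))$ (defined for all large enough $n$) converge in distribution to $Z$.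
   Context: Mixing means that $m(A\cap T^{-n}B)\to m(A)m(B)$ as $n\to\infty$ for all measurable $A,B\subseteq X$. Convergence in distribution of real random variables $Z_n$ (possibly defined on different probability spaces) to $Z$ means $\mathbb{E}(g(Z_n))\to\mathbb{E}(g(Z))$ for every bounded continuous $g:\mathbb{R}\to\mathbb{R}$. *)

(* Defs.v *)
From HB Require Import structures.
From mathcomp Require Import all_boot all_order all_algebra.
From mathcomp Require Import all_classical all_reals all_analysis.
From mathcomp Require Import measurable_realfun.

Set Implicit Arguments.
Unset Strict Implicit.
Unset Printing Implicit Defensive.

Import Order.TTheory GRing.Theory Num.Theory.
Import numFieldNormedType.Exports.

Local Open Scope classical_set_scope.
Local Open Scope ring_scope.

Section measure_preserving_dynamics.
Local Open Scope ereal_scope.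
Context d (X : measurableType d) (R : realType).
Implicit Types (m : probability X R) (T : {mfun X >-> X}).

Definition measure_preserving m T :=
  forall A, measurable A -> m (T @^-1` A) = m A.

Definition ergodic m T :=
  forall A, measurable A -> T @^-1` A = A -> m A = 0 \/ m A = 1.

Definition mixing m T := forall A B, measurable A -> measurable B ->
  m (A `&` iter n T @^-1` B) @[n --> \oo] --> m A * m B.

End measure_preserving_dynamics.

Lemma measurable_fun_iter d (X : measurableType d) (T : {mfun X >-> X}) n :
  measurable_fun setT (iter n T).
Proof.
elim: n => [|n IHn] /=; first exact: measurable_id.
exact: (measurableT_comp (@measurable_funPT _ _ _ _ T) IHn).
Qed.

Section normalized_birkhoff_sum.
Context d (X : measurableType d) (R : realType).
Variables (T : {mfun X >-> X}) (f : {mfun X >-> R}) (B : R^nat) (n : nat).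

Definition birkhoff_sum (x : X) : R := \sum_(0 <= k < n) f (iter k T x).

(* The value at the finitely many indices with [B n = 0] is [0]. *)
Definition normalized_birkhoff_sum (x : X) : R := birkhoff_sum x / B n.

Let measurable_normalized_birkhoff_sum :
  measurable_fun setT normalized_birkhoff_sum.
Proof.
apply: measurable_funM; last exact: measurable_cst.
apply: measurable_sum => k.
exact: (measurableT_comp (@measurable_funPT _ _ _ _ f)
                         (measurable_fun_iter T k)).
Qed.

HB.instance Definition _ := isMeasurableFun.Build _ _ _ _
  normalized_birkhoff_sum measurable_normalized_birkhoff_sum.

End normalized_birkhoff_sum.

(* Each [Z_ n] may live on its own probability space. *)
Definition cvg_in_distribution (R : realType)
    (d : nat -> measure_display) (X : forall n, measurableType (d n))
    (P : forall n, probability (X n) R) (Z_ : forall n, {RV (P n) >-> R})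
    (d' : measure_display) (Y : measurableType d') (Q : probability Y R)
    (Z : {RV Q >-> R}) : Prop :=
  forall g : R -> R, continuous g -> bounded_fun g ->
    ('E_(P n)[g \o Z_ n] @[n --> \oo] --> 'E_Q[g \o Z])%E.

Section density_measure.
Local Open Scope ereal_scope.
Context d (X : measurableType d) (R : realType).
Variables (m : probability X R) (T : {mfun X >-> X}).
Variables phi1 phi2 : {mfun X >-> R}.

(* The nonnegativity proofs are only used by the measure instance below. *)
Definition density_measure (phi1_ge0 : forall x, (0 <= phi1 x)%R)
    (phi2_ge0 : forall x, (0 <= phi2 x)%R) (n : nat) (U : set X) : \bar R :=
  \int[m]_(x in U) (phi1 x * phi2 (iter n T x))%:E.

Hypothesis phi1_ge0 : forall x, (0 <= phi1 x)%R.
Hypothesis phi2_ge0 : forall x, (0 <= phi2 x)%R.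
Variable n : nat.

Local Notation mn := (density_measure phi1_ge0 phi2_ge0 n).

Let density_measure0 : mn set0 = 0.
Proof. exact: integral_set0. Qed.

Let density_measure_ge0 U : 0 <= mn U.
Proof. by apply: integral_ge0 => x _; rewrite lee_fin mulr_ge0. Qed.

Let density_measure_sigma_additive : semi_sigma_additive mn.
Proof.
apply: semi_sigma_additive_nng_induced => [|x]; last first.
  by rewrite lee_fin mulr_ge0.
apply/measurable_EFinP/measurable_funM; first exact: measurable_funPT.
exact: (measurableT_comp (@measurable_funPT _ _ _ _ phi2)
                         (measurable_fun_iter T n)).
Qed.

HB.instance Definition _ := isMeasure.Build _ _ _ mn
  density_measure0 density_measure_ge0 density_measure_sigma_additive.

End density_measure.

(* Main.v *)
Require Import Defs.
From HB Require Import structures.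
From mathcomp Require Import all_boot all_order all_algebra.
From mathcomp Require Import all_classical all_reals all_analysis.
From mathcomp Require Import measurable_realfun.
From mathcomp Require Import ring lra.

(* Call [h_n := g(S_n f / B_n)].  Since [S_n f \o T - S_n f = f \o T^n - f] and
   [B_n] tends to infinity, [h_n \o T - h_n] tends to [0] in [L^1(m)].  Hence in
   [int h_n * phi1 * (phi2 \o T^n)] one may replace [phi1 * (phi2 \o T^n)] by
   its averages along [T^(i L)], [i < K].  The point is to shift [phi1] and
   [phi2 \o T^n] simultaneously: letting [n] tend to infinity, mixing factorises
   the correlations of the shifted products into autocorrelations of [phi1] times
   autocorrelations of [phi2], which are close to [1] when [L] is large, so that
   for large [K] the average is close to the constant [1] in [L^2].  The integral
   is thus asymptotic to [int h_n], whose limit is known.  The argument is carried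
   out for indicators and extended to [L^2] by bilinearity and density. *)

Set Implicit Arguments.
Unset Strict Implicit.
Unset Printing Implicit Defensive.

Import Order.TTheory GRing.Theory Num.Theory.
Import numFieldNormedType.Exports.
Import HBNNSimple.

Local Open Scope classical_set_scope.
Local Open Scope ring_scope.

(** * Square integrable functions *)

(** Expand the nonnegative quantity [eta * (a - eta^-1 * b) ^+ 2]. *)
Lemma ler_mul_weighted_sqr (R : realFieldType) (eta a b : R) : 0 < eta ->
  a * b <= 2^-1 * (eta * a ^+ 2 + eta^-1 * b ^+ 2).
Proof.
move=> eta0; have := mulr_ge0 (ltW eta0) (sqr_ge0 (a - eta^-1 * b)).
have -> : eta * (a - eta^-1 * b) ^+ 2 =
    eta * a ^+ 2 + eta^-1 * b ^+ 2 - 2 * (a * b).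
  by field; exact: lt0r_neq0.
lra.
Qed.

Section real_integrals.
Context d (X : measurableType d) (R : realType) (m : probability X R).
Implicit Types (f g phi psi : X -> R).

Local Notation intg f := (m.-integrable setT (EFin \o f)).

Lemma bounded_integrable (M : R) f :
  measurable_fun setT f -> (forall x, `|f x| <= M) -> intg f.
Proof.
move=> mf fM; apply: measurable_bounded_integrable => //.
  by rewrite ltey_eq fin_num_measure.
exists M; split=> [|y My x _]; first exact: num_real.
exact: le_trans (fM x) (ltW My).
Qed.

Lemma integrable_dominated f g :
  measurable_fun setT f -> intg g -> (forall x, `|f x| <= g x) -> intg f.
Proof.
move=> mf ig fg; apply: (le_integrable _ _ _ ig) => //.
  exact/measurable_EFinP.
by move=> x _; rewrite lee_fin (le_trans (fg x))// ler_norm.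
Qed.

Lemma integrable_measurable f : intg f -> measurable_fun setT f.
Proof. by move/measurable_int/measurable_EFinP. Qed.

Lemma integrableD_EFin f g : intg f -> intg g -> intg (fun x => f x + g x).
Proof. by move=> fi gi; exact: (integrableD _ fi gi). Qed.

Lemma integrableB_EFin f g : intg f -> intg g -> intg (fun x => f x - g x).
Proof. by move=> fi gi; exact: (integrableB _ fi gi). Qed.

Lemma integrableZ_EFin c f : intg f -> intg (fun x => c * f x).
Proof. by move=> fi; exact: (integrableZl _ c fi). Qed.

Lemma integrable_bounded_mul (M : R) f g : measurable_fun setT f ->
  (forall x, `|f x| <= M) -> intg g -> intg (fun x => f x * g x).
Proof.
move=> mf fM gi; apply: (@integrable_dominated _ (fun x => M * `|g x|)).
- by apply: measurable_funM => //; exact: integrable_measurable.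
- by apply: integrableZ_EFin; exact: integrable_norm.
- by move=> x; rewrite normrM ler_wpM2r.
Qed.

Lemma Rintegral1 (c : R) : \int[m]_x c = c.
Proof. by rewrite Rintegral_cst//= probability_setT mulr1. Qed.

Lemma Rintegral_indic A : measurable A -> \int[m]_x \1_A x = fine (m A).
Proof. by move=> mA; rewrite /Rintegral integral_indic// setIT. Qed.

Lemma normr_Rintegral_le f g : intg f -> intg g ->
  (forall x, `|f x| <= g x) -> `|\int[m]_x f x| <= \int[m]_x g x.
Proof.
move=> fi gi fg; apply: (le_trans (le_normr_Rintegral _ fi)) => //.
by apply: le_Rintegral => //; exact: integrable_norm.
Qed.

Lemma Rintegral_sum I (s : seq I) (F : I -> X -> R) :
  (forall i, intg (F i)) ->
  intg (fun x => \sum_(i <- s) F i x) /\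
  \int[m]_x (\sum_(i <- s) F i x) = \sum_(i <- s) \int[m]_x F i x.
Proof.
move=> Fi; elim: s => [|i s [IH1 IH2]].
  split; last by under eq_Rintegral do rewrite big_nil; rewrite Rintegral1 big_nil.
  under eq_fun do rewrite big_nil.
  by apply: (@bounded_integrable 0) => // x; rewrite normr0.
split.
  under eq_fun do rewrite big_cons.
  exact: integrableD_EFin.
under eq_Rintegral do rewrite big_cons.
by rewrite RintegralD// IH2 big_cons.
Qed.

(** Stated for bare functions, so that sums, products and shifts along [T] need no bundling;
    [square_integrable_Lfun] derives it from membership in [Lfun m 2%:E]. *)
Definition square_integrable phi :=
  measurable_fun setT phi /\ intg (fun x => phi x ^+ 2).

Lemma square_integrableM phi psi :
  square_integrable phi -> square_integrable psi ->
  intg (fun x => phi x * psi x).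
Proof.
move=> [mf fi] [mg gi].
apply: (@integrable_dominated _ (fun x => phi x ^+ 2 + psi x ^+ 2)).
- exact: measurable_funM.
- exact: integrableD_EFin.
- move=> x; rewrite normrM.
  rewrite -(real_normK (num_real (phi x))) -(real_normK (num_real (psi x))).
  by have := sqr_ge0 (`|phi x| - `|psi x|); nra.
Qed.

Lemma square_integrable_bounded (M : R) phi :
  measurable_fun setT phi -> (forall x, `|phi x| <= M) -> square_integrable phi.
Proof.
move=> mf fM; split=> //; apply: (@bounded_integrable (M ^+ 2)).
  exact: measurable_funX.
by move=> x; rewrite normrX lerXn2r ?nnegrE// (le_trans _ (fM x)).
Qed.

Lemma square_integrable_indic A : measurable A -> square_integrable (\1_A).
Proof.
move=> mA; apply: (@square_integrable_bounded 1); first exact: measurable_indic.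
by move=> x; rewrite indicE; case: (_ \in _); rewrite ?normr1 ?normr0.
Qed.

Lemma square_integrable_integrable phi : square_integrable phi -> intg phi.
Proof.
move=> fi; rewrite (_ : phi = fun x => phi x * 1); last first.
  by apply/funext => x; rewrite mulr1.
apply: square_integrableM => //.
by apply: (@square_integrable_bounded 1) => // x; rewrite normr1.
Qed.

Lemma square_integrableD phi psi :
  square_integrable phi -> square_integrable psi ->
  square_integrable (fun x => phi x + psi x).
Proof.
move=> fi gi; have [mf f2] := fi; have [mg g2] := gi.
split; first exact: measurable_funD.
rewrite (_ : (fun x => (phi x + psi x) ^+ 2) =
  fun x => (phi x ^+ 2 + 2 * (phi x * psi x)) + psi x ^+ 2); last first.
  by apply/funext => x; ring.
apply: integrableD_EFin => //; apply: integrableD_EFin => //.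
by apply: integrableZ_EFin; exact: square_integrableM.
Qed.

Lemma square_integrableZ c phi :
  square_integrable phi -> square_integrable (fun x => c * phi x).
Proof.
move=> [mf f2]; split; first exact: measurable_funM.
under eq_fun do rewrite exprMn.
exact: integrableZ_EFin.
Qed.

Lemma square_integrableB phi psi :
  square_integrable phi -> square_integrable psi ->
  square_integrable (fun x => phi x - psi x).
Proof.
move=> fi gi.
rewrite (_ : (fun x => phi x - psi x) = fun x => phi x + (-1) * psi x).
  by apply: square_integrableD => //; exact: square_integrableZ.
by apply/funext => x; rewrite mulN1r.
Qed.

Lemma square_integrable_Lfun phi : phi \in Lfun m 2%:E -> square_integrable phi.
Proof.
move=> fi; split; last exact: Lfun2_integrable_sqr.
by move: fi; rewrite inE => /andP[]; rewrite inE.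
Qed.

(* Integrated form of [2 |a b| <= eta a^2 + eta^-1 b^2]; it replaces the
   Cauchy-Schwarz inequality, with [eta] left to be optimised by the caller. *)
Lemma Rintegral_normM_le (eta : R) phi psi : 0 < eta ->
  square_integrable phi -> square_integrable psi ->
  \int[m]_x `|phi x * psi x| <=
  2^-1 * (eta * \int[m]_x (phi x ^+ 2) + eta^-1 * \int[m]_x (psi x ^+ 2)).
Proof.
move=> eta0 fi gi; have [mf f2] := fi; have [mg g2] := gi.
have i1 : intg (fun x => eta * phi x ^+ 2) by exact: integrableZ_EFin.
have i2 : intg (fun x => eta^-1 * psi x ^+ 2) by exact: integrableZ_EFin.
rewrite -(RintegralZl eta measurableT f2) -(RintegralZl eta^-1 measurableT g2).
rewrite -RintegralD// -RintegralZl//; last exact: integrableD_EFin.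
apply: le_Rintegral => //.
- by apply: integrable_norm; exact: square_integrableM.
- by apply: integrableZ_EFin; exact: integrableD_EFin.
- move=> x _; rewrite normrM.
  rewrite -(real_normK (num_real (phi x))) -(real_normK (num_real (psi x))).
  exact: ler_mul_weighted_sqr.
Qed.

(** The variance, that is the integral of [(phi x - c) ^+ 2] with [c] the mean of [phi], is
    nonnegative. *)
Lemma sqr_Rintegral_le phi : square_integrable phi ->
  (\int[m]_x phi x) ^+ 2 <= \int[m]_x (phi x ^+ 2).
Proof.
move=> fi; have [mf f2] := fi; have i1 := square_integrable_integrable fi.
set c := \int[m]_x phi x.
have : 0 <= \int[m]_x ((phi x ^+ 2 - 2 * c * phi x) + c ^+ 2).
  apply: Rintegral_ge0 => x _.
  by rewrite (_ : _ + _ = (phi x - c) ^+ 2) ?sqr_ge0//; ring.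
have ic : intg (fun=> c ^+ 2) by apply: (@bounded_integrable `|c ^+ 2|).
rewrite RintegralD//; last by apply: integrableB_EFin => //; exact: integrableZ_EFin.
rewrite RintegralB//; last exact: integrableZ_EFin.
by rewrite RintegralZl// Rintegral1 -/c; nra.
Qed.

End real_integrals.

(** * Measure preserving maps *)

Section measure_preserving_maps.
Context d (X : measurableType d) (R : realType) (m : probability X R).
Variable S : X -> X.
Hypothesis mS : measurable_fun setT S.
Hypothesis pS : forall A, measurable A -> m (S @^-1` A) = m A.
Implicit Types f phi : X -> R.

Local Notation intg f := (m.-integrable setT (EFin \o f)).

(** Change of variables: the pushforward of [m] under [S] agrees with [m] on measurable sets. *)
Lemma measure_preserving_ge0_integral (f : X -> \bar R) :
  measurable_fun setT f -> (forall x, 0 <= f x)%E ->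
  (\int[m]_x f (S x) = \int[m]_x f x)%E.
Proof.
move=> mf f0; rewrite -[LHS](ge0_integral_pushforward mS m measurableT mf)//.
by apply: eq_measure_integral => A mA _; exact: pS.
Qed.

Lemma measure_preserving_integrable f : intg f -> intg (fun x => f (S x)).
Proof.
move=> /integrableP[mf fi]; apply/integrableP; split.
  exact: (measurableT_comp mf mS).
by rewrite (@measure_preserving_ge0_integral (fun x => `|(f x)%:E|%E))//;
  exact: measurableT_comp.
Qed.

Lemma measure_preserving_Rintegral f :
  intg f -> \int[m]_x f (S x) = \int[m]_x f x.
Proof.
move=> fi; rewrite /Rintegral; congr fine.
have := @integral_pushforward _ _ _ _ _ _ mS m setT (EFin \o f)
  (measurable_int _ fi) (measure_preserving_integrable fi) measurableT.
move=> <-; apply: eq_measure_integral => A mA _; exact: pS.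
Qed.

Lemma measure_preserving_square_integrable phi :
  square_integrable m phi -> square_integrable m (fun x => phi (S x)).
Proof.
move=> [mf f2]; split; first exact: (measurableT_comp mf mS).
exact: (@measure_preserving_integrable (fun x => phi x ^+ 2)).
Qed.

End measure_preserving_maps.

Lemma measure_preserving_iter d (X : measurableType d) (R : realType)
    (m : probability X R) (T : {mfun X >-> X}) (k : nat) :
  measure_preserving m T ->
  forall A, measurable A -> m (iter k T @^-1` A) = m A.
Proof.
move=> Tp; elim: k => [//|k IH] A mA.
rewrite (_ : iter k.+1 T @^-1` A = iter k T @^-1` (T @^-1` A))//.
rewrite IH ?Tp//.
by rewrite -[X in measurable X]setTI; exact: measurable_funPT.
Qed.

(** * Averaging along shifts of a nearly invariant function *)

Section shift_average.
Context d (X : measurableType d) (R : realType) (m : probability X R).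
Variable T : {mfun X >-> X}.
Hypothesis Tp : measure_preserving m T.

Let mT k := measurable_fun_iter T k.
Let pT k := @measure_preserving_iter _ _ _ m T k Tp.

Variables (C : R) (h : X -> R).
Hypothesis mh : measurable_fun setT h.
Hypothesis hC : forall x, `|h x| <= C.

Local Notation intg f := (m.-integrable setT (EFin \o f)).

Let mcomp (f : X -> R) k :
  measurable_fun setT f -> measurable_fun setT (fun x => f (iter k T x)).
Proof. by move=> mf; exact: (measurableT_comp mf (mT k)). Qed.

Let integrable_shift k : intg (fun x => `|h (iter k T x) - h x|).
Proof.
apply: (@bounded_integrable _ _ _ _ (C + C)).
  by apply: measurableT_comp => //; apply: measurable_funB => //; exact: mcomp.
by move=> x; rewrite normr_id (le_trans (ler_normB _ _))// lerD.
Qed.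

(** The triangle inequality passes through the intermediate iterates, and by invariance each of the
    [k] increments has the same integral as the first. *)
Lemma Rintegral_shift_le k :
  \int[m]_x `|h (iter k T x) - h x| <= k%:R * \int[m]_x `|h (T x) - h x|.
Proof.
elim: k => [|k IH].
  rewrite mul0r; under eq_Rintegral do rewrite /= subrr normr0.
  by rewrite Rintegral1.
rewrite -natr1 mulrDl mul1r.
have i1 : intg (fun x => `|h (T (iter k T x)) - h (iter k T x)|).
  exact: (measure_preserving_integrable (mT k) (@pT k) (@integrable_shift 1)).
rewrite -[X in _ <= _ + X](_ : \int[m]_x `|h (T (iter k T x)) - h (iter k T x)| =
    _); last first.
  exact: (measure_preserving_Rintegral (mT k) (@pT k) (@integrable_shift 1)).
rewrite addrC; apply: (le_trans _ (lerD (lexx _) IH)).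
rewrite -RintegralD//; apply: le_Rintegral => //.
  exact: integrableD_EFin.
by move=> x _; rewrite iterS (le_trans _ (ler_normD _ _))// addrA subrK.
Qed.

Variable u : X -> R.
Hypothesis mu : measurable_fun setT u.
Hypothesis u1 : forall x, `|u x| <= 1.

Let iu k : intg (fun x => u (iter k T x)).
Proof. by apply: (@bounded_integrable _ _ _ _ 1) => //; exact: mcomp. Qed.

Let ihu j k : intg (fun x => h (iter j T x) * u (iter k T x)).
Proof.
by apply: (@integrable_bounded_mul _ _ _ _ C) => //; exact: mcomp.
Qed.

Let iuu j k : intg (fun x => u (iter j T x) * u (iter k T x)).
Proof.
by apply: (@integrable_bounded_mul _ _ _ _ 1) => //; exact: mcomp.
Qed.

(** By invariance the first integral is that of [(h \o T^k) * (u \o T^k)], so the difference is the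
    integral of [(h \o T^k - h) * (u \o T^k)], where [|u| <= 1]. *)
Lemma Rintegral_shift_dist k :
  `|\int[m]_x (h x * u x) - \int[m]_x (h x * u (iter k T x))| <=
  k%:R * \int[m]_x `|h (T x) - h x|.
Proof.
have <- := measure_preserving_Rintegral (mT k) (@pT k) (ihu 0 0).
have := @ihu k k; have := @ihu 0 k => /= i0 ik.
rewrite -RintegralB//; apply: le_trans (Rintegral_shift_le k).
apply: normr_Rintegral_le => //; first exact: integrableB_EFin.
by move=> x; rewrite -mulrBl normrM ler_piMr.
Qed.

(* The shift changes [h] little, so [u] may be replaced by the average of
   [u \o T^(i L)], [i < K], which is small in [L^2] when these functions are
   almost uncorrelated. *)
Lemma Rintegral_average_le (K L : nat) (eps eta : R) :
  (0 < K)%N -> 0 < eta -> 0 <= eps ->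
  (forall l, (0 < l < K)%N -> \int[m]_x (u x * u (iter (l * L) T x)) <= eps) ->
  `|\int[m]_x (h x * u x)| <=
  (K * L)%:R * \int[m]_x `|h (T x) - h x| +
  C / 2 * (eta + (K%:R^-1 + eps) / eta).
Proof.
move=> K0 eta0 eps0 corr.
set D := \int[m]_x `|h (T x) - h x|.
set J := \int[m]_x (h x * u x).
have K0' : 0 < K%:R :> R by rewrite ltr0n.
have D0 : 0 <= D by exact: Rintegral_ge0.
pose V x := \sum_(i < K) u (iter (i * L) T x).
have mV : measurable_fun setT V by apply: measurable_sum => i; exact: mcomp.
have VK x : `|V x| <= K%:R.
  apply: (le_trans (ler_norm_sum _ _ _)).
  by rewrite -[K in K%:R]card_ord -sumr_const ler_sum.
have sqV := square_integrable_bounded m mV VK.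
(* A negative bound [C] would force [X] to be empty, which contradicts total mass [1]. *)
have C0 : 0 <= C.
  rewrite leNgt; apply/negP => C0.
  have : (m setT <= m set0)%E.
    rewrite le_measure ?inE// => x _.
    by have := hC x; rewrite leNgt (lt_le_trans C0).
  by rewrite measure0 probability_setT leNgt lte01.
have shift : `|K%:R * J - \int[m]_x (h x * V x)| <= K%:R * ((K * L)%:R * D).
  have -> : \int[m]_x (h x * V x) =
      \sum_(i < K) \int[m]_x (h x * u (iter (i * L) T x)).
    under eq_Rintegral do rewrite mulr_sumr.
    by apply: (Rintegral_sum _ _).2 => i; exact: (@ihu 0).
  have -> : K%:R * J = \sum_(i < K) J.
    by rewrite sumr_const card_ord mulr_natl.
  rewrite -sumrB (le_trans (ler_norm_sum _ _ _))//.
  have -> : K%:R * ((K * L)%:R * D) = \sum_(i < K) ((K * L)%:R * D).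
    by rewrite sumr_const card_ord mulr_natl.
  apply: ler_sum => i _; apply: (le_trans (Rintegral_shift_dist _)).
  by rewrite ler_wpM2r// ler_nat leq_mul2r ltnW ?orbT.
(* Expand the square into a double sum: a term off the diagonal is at most [eps], and one on the
   diagonal at most [1], hence at most [1 + eps]. *)
have V2 : \int[m]_x (V x ^+ 2) <= K%:R + K%:R ^+ 2 * eps.
  have -> : \int[m]_x (V x ^+ 2) =
      \sum_(i < K) \sum_(j < K)
        \int[m]_x (u (iter (i * L) T x) * u (iter (j * L) T x)).
    have e i := Rintegral_sum (index_enum 'I_K)
       (fun j : 'I_K => iuu (i * L) (j * L)).
    under [RHS]eq_bigr => i _ do rewrite -(e i).2.
    rewrite -(Rintegral_sum _ (fun i : 'I_K => (e i).1)).2.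
    apply: eq_Rintegral => x _; rewrite expr2 mulr_suml.
    by apply: eq_bigr => i _; rewrite mulr_sumr.
  (* Invariance removes the common shift by [i * L] and leaves the lag [(j - i) * L], which [corr]
     controls. *)
  have le_corr (i j : 'I_K) : (i < j)%N ->
      \int[m]_x (u (iter (i * L) T x) * u (iter (j * L) T x)) <= eps.
    move=> ij; apply: (le_trans _ (corr (j - i)%N _)); last first.
      by rewrite subn_gt0 ij (leq_ltn_trans (leq_subr _ _)).
    rewrite -(measure_preserving_Rintegral (mT (i * L)) (@pT (i * L)) (iuu 0 _)).
    rewrite le_eqVlt; apply/orP; left; apply/eqP/eq_Rintegral => x _ /=.
    by rewrite -iterD -mulnDl subnK// ltnW.
  have -> : K%:R + K%:R ^+ 2 * eps =
      \sum_(i < K) \sum_(j < K) ((i == j)%:R + eps).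
    transitivity (\sum_(i < K) (1 + K%:R * eps)); last first.
      apply: eq_bigr => i _; rewrite big_split/= sumr_const card_ord mulr_natl.
      rewrite (bigD1 i)//= eqxx big1 ?addr0// => j /negbTE ji.
      by rewrite eq_sym ji.
    by rewrite sumr_const card_ord -[in RHS]mulr_natl; ring.
  apply: ler_sum => i _; apply: ler_sum => j _.
  have [ij|ji|/ord_inj ->] := ltngtP i j.
  - by rewrite (le_trans (le_corr _ _ ij))// lerDr.
  - under eq_Rintegral do rewrite mulrC.
    by rewrite (le_trans (le_corr _ _ ji))// lerDr.
  - rewrite eqxx (@le_trans _ _ 1)//; last by rewrite lerDl.
    rewrite -[leRHS](Rintegral1 m); apply: le_Rintegral => //.
      by apply: (@bounded_integrable _ _ _ _ 1) => // x; rewrite normr1.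
    move=> x _; rewrite (le_trans (ler_norm _))// normrM.
    by rewrite mulr_ile1.
(* The weighted inequality is applied to [1] and [V]. Since [V] is a sum of [K] terms, the weight is
   [eta * K%:R]; dividing by [K] later leaves a bound in [eta] alone. *)
have hV : `|\int[m]_x (h x * V x)| <=
    C * (2^-1 * (eta * K%:R + (eta * K%:R)^-1 * \int[m]_x (V x ^+ 2))).
  have one : square_integrable m (fun=> 1 : R).
    by apply: (@square_integrable_bounded _ _ _ _ 1) => // x; rewrite normr1.
  have iV : intg (fun x => `|V x|).
    by apply: integrable_norm; exact: square_integrable_integrable.
  apply: (@le_trans _ _ (C * \int[m]_x `|V x|)).
    rewrite -RintegralZl//; apply: normr_Rintegral_le.
    - apply: (@integrable_bounded_mul _ _ _ _ C) => //.
      exact: square_integrable_integrable.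
    - exact: integrableZ_EFin.
    - by move=> x; rewrite normrM ler_wpM2r.
  apply: ler_wpM2l => //.
  have := @Rintegral_normM_le _ _ _ m (eta * K%:R) _ _ (mulr_gt0 eta0 K0') one sqV.
  under eq_Rintegral do rewrite mul1r.
  by under [X in _ <= _ * (_ * X + _) -> _]eq_Rintegral do rewrite expr1n;
    rewrite Rintegral1 mulr1.
rewrite -(ler_pM2l K0').
rewrite -[K%:R * `|J|](ger0_norm (mulr_ge0 (ltW K0') (normr_ge0 _))).
rewrite normrM normr_id -normrM.
have := ler_normD (K%:R * J - \int[m]_x (h x * V x)) (\int[m]_x (h x * V x)).
rewrite subrK => /le_trans; apply.
rewrite mulrDr lerD// (le_trans hV)//.
rewrite (_ : K%:R * _ = C * (2^-1 * (eta * K%:R +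
    (eta * K%:R)^-1 * (K%:R + K%:R ^+ 2 * eps)))); last first.
  by field; rewrite !lt0r_neq0.
do 2 (apply: ler_wpM2l => //); rewrite lerD2l ler_wpM2l//.
by rewrite invr_ge0 mulr_ge0// ltW.
Qed.

End shift_average.

(** * Asymptotic independence under mixing *)

Section mixing_correlations.
Context d (X : measurableType d) (R : realType) (m : probability X R).
Variable T : {mfun X >-> X}.
Hypotheses (Tp : measure_preserving m T) (Tmix : mixing m T).

Let mT k := measurable_fun_iter T k.
Let pT k := @measure_preserving_iter _ _ _ m T k Tp.

Local Notation intg f := (m.-integrable setT (EFin \o f)).

Let mTpre k A : measurable A -> measurable (iter k T @^-1` A).
Proof. by move=> mA; rewrite -[X in measurable X]setTI; exact: mT. Qed.

Lemma mixing_fine A B : measurable A -> measurable B ->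
  fine (m (A `&` iter n T @^-1` B)) @[n --> \oo] --> fine (m A) * fine (m B).
Proof.
move=> mA mB; rewrite -fineM ?fin_num_measure//.
apply: fine_cvg; rewrite fineK ?fin_numM ?fin_num_measure//.
exact: Tmix.
Qed.

Variables A B : set X.
Hypotheses (mA : measurable A) (mB : measurable B).

Let a := fine (m A).
Let b := fine (m B).
Let w n x : R := \1_A x * \1_B (iter n T x).

Let mw n : measurable_fun setT (w n).
Proof.
apply: measurable_funM; first exact: measurable_indic.
by apply: (measurableT_comp _ (mT n)); exact: measurable_indic.
Qed.

Let w01 n x : 0 <= w n x <= 1.
Proof.
by rewrite /w !indicE; case: (_ \in A); case: (_ \in B);
  rewrite ?mulr1 ?mulr0 ?lexx ?ler01.
Qed.

Let wE n x : w n x = \1_(A `&` iter n T @^-1` B) x.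
Proof. by rewrite indicI. Qed.

Let ab01 : 0 <= a * b <= 1.
Proof.
have f01 E : 0 <= fine (m E) by rewrite fine_ge0.
have f1 E : measurable E -> fine (m E) <= 1.
  by move=> mE; rewrite -lee_fin fineK ?fin_num_measure// probability_le1.
apply/andP; split; first by apply: mulr_ge0; exact: f01.
by apply: mulr_ile1; [exact: f01|exact: f01|exact: f1|exact: f1].
Qed.

Lemma centered_indic_le1 n x : `|w n x - a * b| <= 1.
Proof. by rewrite ler_norml; have := w01 n x; have := ab01; lra. Qed.

Lemma measurable_centered_indic n : measurable_fun setT (fun x => w n x - a * b).
Proof. exact: measurable_funB. Qed.

Let corr l n := \int[m]_x ((w n x - a * b) * (w n (iter l T x) - a * b)).

Let autocorr E l := fine (m (E `&` iter l T @^-1` E)).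

(** As [T^l] and [T^n] commute, [w n * (w n \o T^l)] is the indicator of the intersection of [A] and
    [T^-l A] with the preimage under [T^n] of the intersection of [B] and [T^-l B]. For fixed [l],
    mixing factorises its measure as [n] grows, and the mean of [w n] tends to [a * b]. *)
Lemma cvg_centered_corr l :
  corr l n @[n --> \oo] --> autocorr A l * autocorr B l - (a * b) ^+ 2.
Proof.
have iw n k : intg (fun x => w n (iter k T x)).
  apply: (@bounded_integrable _ _ _ _ 1).
    by apply: (measurableT_comp _ (mT k)); exact: mw.
  by move=> x; rewrite ger0_norm; have /andP[] := w01 n (iter k T x).
have iww n : intg (fun x => w n x * w n (iter l T x)).
  apply: (@integrable_bounded_mul _ _ _ _ 1) => //.
  by move=> x; rewrite ger0_norm; have /andP[] := w01 n x.
have E n : corr l n =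
    fine (m ((A `&` iter l T @^-1` A) `&`
      iter n T @^-1` (B `&` iter l T @^-1` B))) -
    (2 * (a * b)) * fine (m (A `&` iter n T @^-1` B)) + (a * b) ^+ 2.
  have <- : \int[m]_x w n x = fine (m (A `&` iter n T @^-1` B)).
    rewrite -Rintegral_indic; last by apply: measurableI => //; exact: mTpre.
    by apply: eq_Rintegral => x _; rewrite wE.
  have <- : \int[m]_x (w n x * w n (iter l T x)) =
    fine (m ((A `&` iter l T @^-1` A) `&`
      iter n T @^-1` (B `&` iter l T @^-1` B))).
    rewrite -Rintegral_indic; last first.
      by apply: measurableI; [|apply: mTpre];
        apply: measurableI => //; exact: mTpre.
    apply: eq_Rintegral => x _; rewrite !wE !indicE -natrM mulnb; congr (_%:R).
    congr nat_of_bool; apply/idP/idP.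
      move=> /andP[/set_mem[/= Ax Bx] /set_mem[/= Alx Blx]].
      apply/mem_set; split=> //=; split => //=.
      by rewrite -iterD addnC iterD.
    move=> /set_mem[[/= Ax Alx] [/= Bx Blx]].
    apply/andP; split; apply/mem_set; split => //=.
    by rewrite -iterD addnC iterD.
  rewrite /corr.
  have i0 := iw n 0; have il := iw n l.
  have ic : intg (fun=> (a * b) ^+ 2).
    exact: (@bounded_integrable _ _ _ _ `|(a * b) ^+ 2|).
  transitivity (\int[m]_x (w n x * w n (iter l T x) - (a * b) * w n x -
      (a * b) * w n (iter l T x) + (a * b) ^+ 2)).
    by apply: eq_Rintegral => x _; ring.
  have ia : intg (fun x => (a * b) * w n x) by exact: integrableZ_EFin.
  have ib : intg (fun x => (a * b) * w n (iter l T x)).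
    exact: integrableZ_EFin.
  have i2 := integrableB_EFin (iww n) ia.
  rewrite RintegralD//; last exact: (integrableB_EFin i2 ib).
  rewrite Rintegral1 RintegralB// RintegralB// !RintegralZl//.
  rewrite (measure_preserving_Rintegral (mT l) (@pT l) i0).
  ring.
rewrite (_ : _ - _ = autocorr A l * autocorr B l - 2 * (a * b) * (a * b) +
  (a * b) ^+ 2); last by ring.
under eq_fun do rewrite E.
apply: cvgD; last exact: cvg_cst.
apply: cvgB; first by apply: mixing_fine; apply: measurableI => //; exact: mTpre.
by apply: cvgMr; exact: mixing_fine.
Qed.

(** Mixing is applied a second time, now in the lag [l]: the two autocorrelations tend to [a * a]
    and [b * b]. *)
Lemma cvg_autocorr :
  (autocorr A l * autocorr B l - (a * b) ^+ 2) @[l --> \oo] --> 0.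
Proof.
rewrite -(subrr ((a * b) ^+ 2)); apply: cvgB; last exact: cvg_cst.
rewrite (_ : (a * b) ^+ 2 = (a * a) * (b * b)); last by ring.
by apply: cvgM; exact: mixing_fine.
Qed.

End mixing_correlations.

Section asymptotic_independence.
Context d (X : measurableType d) (R : realType) (m : probability X R).
Variable T : {mfun X >-> X}.
Hypotheses (Tp : measure_preserving m T) (Tmix : mixing m T).

Variables (C : R) (h : nat -> X -> R).
Hypothesis C0 : 0 < C.
Hypothesis mh : forall n, measurable_fun setT (h n).
Hypothesis hC : forall n x, `|h n x| <= C.
Hypothesis hT : \int[m]_x `|h n (T x) - h n x| @[n --> \oo] --> 0.

Local Notation intg f := (m.-integrable setT (EFin \o f)).

(** When [phi] and [psi] have integral [1], this compares the integral of [h n] against the density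
    [phi * (psi \o T^n)] with its integral against [m]. It is bilinear in [phi] and [psi], which the
    density argument exploits. *)
Definition decorrelation (phi psi : X -> R) (n : nat) : R :=
  \int[m]_x (h n x * (phi x * psi (iter n T x))) -
  \int[m]_x h n x * (\int[m]_x phi x * \int[m]_x psi x).

(** The quantity equals the integral of [h n * u n] with [u n] the centred indicator, so
    [Rintegral_average_le] applies. The spacing [L] and the number [K] of shifts are fixed first, in
    terms of [eps]; only then does [n] tend to infinity. *)
Lemma cvg_decorrelation_indic A B : measurable A -> measurable B ->
  decorrelation (\1_A) (\1_B) n @[n --> \oo] --> 0.
Proof.
move=> mA mB.
pose p := fine (m A) * fine (m B).
pose u n x : R := \1_A x * \1_B (iter n T x) - p.
have mu n : measurable_fun setT (u n) by exact: measurable_centered_indic.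
have u1 n x : `|u n x| <= 1 by exact: centered_indic_le1.
have E n : decorrelation (\1_A) (\1_B) n = \int[m]_x (h n x * u n x).
  rewrite /decorrelation !Rintegral_indic// -/p.
  have ih : intg (h n) by exact: (@bounded_integrable _ _ _ _ C).
  rewrite -RintegralZr// -RintegralB//.
  - by apply: eq_Rintegral => x _; rewrite /u mulrBr.
  - apply: (@integrable_bounded_mul _ _ _ _ C) => //.
    apply: square_integrableM; first exact: square_integrable_indic.
    apply: (measure_preserving_square_integrable (measurable_fun_iter T n)).
      exact: measure_preserving_iter.
    exact: square_integrable_indic.
  - by under eq_fun do rewrite mulrC; exact: integrableZ_EFin.
apply/cvgr0Pnorm_lt => e e0.
(* With [K%:R^-1 <= eps] and [eps = eta ^+ 2 / 2], the quotient [(K%:R^-1 + eps) / eta] is at most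
   [eta], so the second term of the averaging bound is at most [C * eta = e / 4]. *)
pose eta := e / (4 * C).
have eta0 : 0 < eta by rewrite divr_gt0// mulr_gt0.
pose eps := eta ^+ 2 / 2.
have eps0 : 0 < eps by rewrite divr_gt0// exprn_gt0.
have /cvgr_lt/(_ _ eps0)[L _ HL] := cvg_autocorr Tmix mA mB.
pose K := (Num.truncn (eps^-1)).+1.
have K1 : K%:R^-1 <= eps.
  rewrite -[leRHS]invrK lef_pV2 ?posrE ?invr_gt0//.
  by apply: ltW; exact: truncnS_gt.
(* The successor keeps [K * L1] positive, so that it can be divided by; each lag [l * L1] with
   [l > 0] is still at least [L]. *)
pose L1 := L.+1.
(* Only finitely many lags occur, so their eventual bounds hold simultaneously. *)
have corr : \forall n \near \oo, forall l : 'I_K, (0 < l)%N ->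
    \int[m]_x (u n x * u n (iter (l * L1) T x)) <= eps.
  apply: filter_forall => l.
  have [->|l0] := posnP l; first exact: nearW.
  have Ll : (L <= l * L1)%N by rewrite (leq_trans (leqnSn L))// leq_pmull.
  have /cvgr_le/(_ _ (HL _ Ll)) :=
    @cvg_centered_corr _ _ _ m T Tp Tmix A B mA mB (l * L1)%N.
  by apply: filterS => n + _.
have KL0 : 0 < (K * L1)%:R :> R by rewrite ltr0n.
have D_small : \forall n \near \oo,
    \int[m]_x `|h n (T x) - h n x| < e / 2 / (K * L1)%:R.
  by apply: (cvgr_lt _ hT); rewrite !divr_gt0.
near=> n.
have D_n : \int[m]_x `|h n (T x) - h n x| < e / 2 / (K * L1)%:R by near: n.
have corr_n : forall l, (0 < l < K)%N ->
    \int[m]_x (u n x * u n (iter (l * L1) T x)) <= eps.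
  have H : forall l : 'I_K, (0 < l)%N ->
    \int[m]_x (u n x * u n (iter (l * L1) T x)) <= eps by near: n.
  by move=> l /andP[l0 lK]; exact: (H (Ordinal lK)).
rewrite E.
apply: (le_lt_trans (Rintegral_average_le Tp (mh n) (hC n) (mu n) (u1 n)
  (isT : (0 < K)%N) eta0 (ltW eps0) corr_n)).
rewrite ltr_pdivlMr// mulrC in D_n.
have : C / 2 * (eta + (K%:R^-1 + eps) / eta) <= e / 4.
  have -> : e / 4 = C / 2 * (eta + eta).
    by rewrite /eta; field; exact: lt0r_neq0.
  apply: ler_wpM2l; first by rewrite divr_ge0// ltW.
  rewrite lerD2l ler_pdivrMr// -expr2.
  by rewrite (_ : eta ^+ 2 = eps + eps) ?lerD2r// /eps; field.
by move: D_n e0; lra.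
Unshelve. all: by end_near.
Qed.

End asymptotic_independence.

(** * Approximation by simple functions *)

Lemma nnsfun_sum_indic d (X : measurableType d) (R : realType)
    (s : {nnsfun X >-> R}) :
  exists n (c : 'I_n -> R) (A : 'I_n -> set X), (forall i, measurable (A i)) /\
    (s : X -> R) = fun x => \sum_(i < n) c i * \1_(A i) x.
Proof.
do 3 eexists; split; last by apply/funext => x; exact: fimfunEord.
by move=> i /=; exact: measurable_sfunP.
Qed.

(** Simple functions [s n] with [0 <= s n <= phi] converge pointwise to [phi], and
    [(phi - s n) ^+ 2 <= phi ^+ 2] allows dominated convergence. *)
Lemma nnsfun_square_approx d (X : measurableType d) (R : realType)
    (m : probability X R) (phi : X -> R) (e : R) :
  (forall x, 0 <= phi x) -> square_integrable m phi -> 0 < e ->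
  exists2 s : {nnsfun X >-> R}, square_integrable m s &
    \int[m]_x ((phi x - s x) ^+ 2) < e.
Proof.
move=> phi0 phi2 e0; have [mphi iphi] := phi2.
have mEphi : measurable_fun setT (EFin \o phi) by exact/measurable_EFinP.
pose s n : {nnsfun X >-> R} := nnsfun_approx measurableT mEphi n.
have ephi0 x : setT x -> (0 <= (EFin \o phi) x)%E by rewrite lee_fin.
have cvgs x : s n x @[n --> \oo] --> phi x.
  have /fine_cvgP[_] := cvg_nnsfun_approx measurableT mEphi ephi0 (I : setT x).
  exact.
have les n x : s n x <= phi x.
  by rewrite -lee_fin /s nnsfun_approxE; exact: le_approx.
have s2 n : square_integrable m (s n).
  split=> //; apply: (integrable_dominated _ iphi).
    exact: measurable_funX.
  move=> x; rewrite normrX lerXn2r ?nnegrE//.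
  by rewrite ger0_norm.
have is2 n : m.-integrable setT (EFin \o (fun x => (phi x - s n x) ^+ 2)).
  by have [] := square_integrableB phi2 (s2 n).
have : \int[m]_x ((phi x - s n x) ^+ 2) @[n --> \oo] --> 0.
  have [|||_ _] := @dominated_convergence _ _ _ m setT measurableT
    (fun n x => ((phi x - s n x) ^+ 2)%:E) (cst 0%E)
    (EFin \o (fun x => phi x ^+ 2))
    (fun n => measurable_int _ (is2 n)) (measurable_cst _).
  - apply: aeW => x _; apply/fine_cvgP; split; first exact: nearW.
    have c : phi x - s n x @[n --> \oo] --> 0.
      by rewrite -(subrr (phi x)); apply: cvgB => //; exact: cvg_cst.
    by rewrite -(mulr0 0); exact: (cvgM c c).
  - exact: iphi.
  - apply: aeW => x n _; rewrite lee_fin ger0_norm ?sqr_ge0//.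
    by rewrite lerXn2r ?nnegrE ?subr_ge0// gerBl.
  - by rewrite integral0 => /fine_cvgP[_].
move=> /cvgr_lt/(_ _ e0)[N _ HN].
by exists (s N) => //; exact: (HN N (leqnn N)).
Qed.

(** The limit step of the density argument: [v] may depend on [e], but the error is uniform in
    [n]. *)
Lemma cvgr0_approx (R : realType) (u : R^nat) :
  (forall e, 0 < e -> exists2 v : R^nat, v n @[n --> \oo] --> 0 &
    forall n, `|u n - v n| <= e) ->
  u n @[n --> \oo] --> 0.
Proof.
move=> H; apply/cvgr0Pnorm_le => e e0.
have [v v0 uv] := H _ (divr_gt0 e0 (ltr0Sn _ 1)).
near=> n.
have vn : `|v n| <= e / 2.
  by near: n; apply/cvgr0_norm_le => //; exact: divr_gt0.
have := uv n; have := ler_normD (u n - v n) (v n).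
by rewrite subrK; move: vn; lra.
Unshelve. all: by end_near.
Qed.

(** * Extension from indicators to square integrable functions *)

Section asymptotic_independence_L2.
Context d (X : measurableType d) (R : realType) (m : probability X R).
Variable T : {mfun X >-> X}.
Hypotheses (Tp : measure_preserving m T) (Tmix : mixing m T).

Variables (C : R) (h : nat -> X -> R).
Hypothesis C0 : 0 < C.
Hypothesis mh : forall n, measurable_fun setT (h n).
Hypothesis hC : forall n x, `|h n x| <= C.
Hypothesis hT : \int[m]_x `|h n (T x) - h n x| @[n --> \oo] --> 0.

Implicit Types phi psi : X -> R.

Local Notation intg f := (m.-integrable setT (EFin \o f)).
Local Notation sqint := (square_integrable m).
Local Notation decorr := (decorrelation m T h).

Let sqint_iter n phi : sqint phi -> sqint (fun x => phi (iter n T x)).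
Proof.
apply: (measure_preserving_square_integrable (measurable_fun_iter T n)).
exact: measure_preserving_iter.
Qed.

Lemma integrable_decorrelation phi psi n : sqint phi -> sqint psi ->
  intg (fun x => h n x * (phi x * psi (iter n T x))).
Proof.
move=> fi gi; apply: (@integrable_bounded_mul _ _ _ _ C) => //.
by apply: square_integrableM => //; exact: sqint_iter.
Qed.

(** The combination [a * phi + phi'] serves both the induction on finite sums and, with [a = -1],
    differences. *)
Lemma decorrelation_linearl a phi phi' psi n :
  sqint phi -> sqint phi' -> sqint psi ->
  decorr (fun x => a * phi x + phi' x) psi n =
  a * decorr phi psi n + decorr phi' psi n.
Proof.
move=> fi fi' gi; have i1 := integrable_decorrelation n fi gi.
have i2 := integrable_decorrelation n fi' gi.
have j1 := square_integrable_integrable fi.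
have j2 := square_integrable_integrable fi'.
rewrite /decorrelation RintegralD//; last exact: integrableZ_EFin.
rewrite RintegralZl//.
rewrite -[X in X - _](_ : \int[m]_x (a * (h n x * (phi x * psi (iter n T x))) +
  h n x * (phi' x * psi (iter n T x))) = _); last first.
  by apply: eq_Rintegral => x _; ring.
rewrite RintegralD//; last exact: integrableZ_EFin.
rewrite RintegralZl//; ring.
Qed.

Lemma decorrelation_linearr a phi psi psi' n :
  sqint phi -> sqint psi -> sqint psi' ->
  decorr phi (fun x => a * psi x + psi' x) n =
  a * decorr phi psi n + decorr phi psi' n.
Proof.
move=> fi gi gi'; have i1 := integrable_decorrelation n fi gi.
have i2 := integrable_decorrelation n fi gi'.
have j1 := square_integrable_integrable gi.
have j2 := square_integrable_integrable gi'.
rewrite /decorrelation.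
rewrite (@RintegralD _ _ _ _ _ (fun x => a * psi x))//; last exact: integrableZ_EFin.
rewrite RintegralZl//.
rewrite -[X in X - _](_ : \int[m]_x (a * (h n x * (phi x * psi (iter n T x))) +
  h n x * (phi x * psi' (iter n T x))) = _); last first.
  by apply: eq_Rintegral => x _; ring.
rewrite RintegralD//; last exact: integrableZ_EFin.
rewrite RintegralZl//; ring.
Qed.

Let sqint_sum I (s : seq I) (c : I -> R) (F : I -> X -> R) :
  (forall i, sqint (F i)) -> sqint (fun x => \sum_(i <- s) c i * F i x).
Proof.
move=> Fi; elim: s => [|i s IH].
  under eq_fun do rewrite big_nil.
  by apply: (@square_integrable_bounded _ _ _ _ 0) => // x; rewrite normr0.
under eq_fun do rewrite big_cons.
by apply: square_integrableD => //; exact: square_integrableZ.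
Qed.

Lemma cvg_decorrelation_suml I (s : seq I) (c : I -> R) (F : I -> X -> R) psi :
  (forall i, sqint (F i)) -> sqint psi ->
  (forall i, decorr (F i) psi n @[n --> \oo] --> 0) ->
  decorr (fun x => \sum_(i <- s) c i * F i x) psi n @[n --> \oo] --> 0.
Proof.
move=> Fi gi H; elim: s => [|i s IH].
  rewrite (_ : decorr _ _ = cst 0); first exact: cvg_cst.
  apply/funext => n; rewrite /decorrelation.
  under eq_Rintegral do rewrite big_nil mul0r mulr0.
  under [X in _ * (X * _)]eq_Rintegral do rewrite big_nil.
  by rewrite !Rintegral1 mul0r mulr0 subrr.
have -> : (fun x => \sum_(j <- i :: s) c j * F j x) =
    fun x => c i * F i x + \sum_(j <- s) c j * F j x.
  by apply/funext => x; rewrite big_cons.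
have -> : decorr (fun x => c i * F i x + \sum_(j <- s) c j * F j x) psi =
    fun n => c i * decorr (F i) psi n +
      decorr (fun x => \sum_(j <- s) c j * F j x) psi n.
  apply/funext => n; apply: decorrelation_linearl => //.
  exact: sqint_sum.
rewrite -[X in _ --> X](addr0 0) -[X in _ --> X + _](mulr0 (c i)).
by apply: cvgD => //; apply: cvgMr; exact: H.
Qed.

Lemma cvg_decorrelation_sumr I (s : seq I) (c : I -> R) (F : I -> X -> R) phi :
  (forall i, sqint (F i)) -> sqint phi ->
  (forall i, decorr phi (F i) n @[n --> \oo] --> 0) ->
  decorr phi (fun x => \sum_(i <- s) c i * F i x) n @[n --> \oo] --> 0.
Proof.
move=> Fi gi H; elim: s => [|i s IH].
  rewrite (_ : decorr _ _ = cst 0); first exact: cvg_cst.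
  apply/funext => n; rewrite /decorrelation.
  under eq_Rintegral do rewrite big_nil !mulr0.
  under [X in _ * (_ * X)]eq_Rintegral do rewrite big_nil.
  by rewrite !Rintegral1 !mulr0 subrr.
have -> : (fun x => \sum_(j <- i :: s) c j * F j x) =
    fun x => c i * F i x + \sum_(j <- s) c j * F j x.
  by apply/funext => x; rewrite big_cons.
have -> : decorr phi (fun x => c i * F i x + \sum_(j <- s) c j * F j x) =
    fun n => c i * decorr phi (F i) n +
      decorr phi (fun x => \sum_(j <- s) c j * F j x) n.
  apply/funext => n; apply: decorrelation_linearr => //.
  exact: sqint_sum.
rewrite -[X in _ --> X](addr0 0) -[X in _ --> X + _](mulr0 (c i)).
by apply: cvgD => //; apply: cvgMr; exact: H.
Qed.

Lemma cvg_decorrelation_simple (s t : {nnsfun X >-> R}) :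
  decorr s t n @[n --> \oo] --> 0.
Proof.
have [n [c [A [mA ->]]]] := nnsfun_sum_indic s.
have [p [b [B [mB ->]]]] := nnsfun_sum_indic t.
apply: cvg_decorrelation_suml.
- by move=> i; exact: square_integrable_indic.
- by apply: sqint_sum => i; exact: square_integrable_indic.
- move=> i; apply: cvg_decorrelation_sumr.
  + by move=> j; exact: square_integrable_indic.
  + exact: square_integrable_indic.
  + by move=> j; exact: (cvg_decorrelation_indic Tp Tmix C0 mh hC hT).
Qed.

(** Each of the two terms of [decorr] contributes half of the bound, through the weighted
    inequality. The bound is uniform in [n] because [psi \o T^n] and [psi] have squares of equal
    integral. *)
Lemma decorrelation_le (eta : R) phi psi n : 0 < eta ->
  sqint phi -> sqint psi ->
  `|decorr phi psi n| <=
  C * (eta * \int[m]_x (phi x ^+ 2) + eta^-1 * \int[m]_x (psi x ^+ 2)).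
Proof.
move=> eta0 fi gi; rewrite /decorrelation.
set I := \int[m]_x (phi x ^+ 2); set J := \int[m]_x (psi x ^+ 2).
have giT := sqint_iter n gi.
have J_iter : \int[m]_x (psi (iter n T x) ^+ 2) = J.
  exact: (measure_preserving_Rintegral (measurable_fun_iter T n)
    (measure_preserving_iter n Tp) gi.2).
have ifg : intg (fun x => `|phi x * psi (iter n T x)|).
  by apply: integrable_norm; exact: square_integrableM.
have le1 : `|\int[m]_x (h n x * (phi x * psi (iter n T x)))| <=
    C * (2^-1 * (eta * I + eta^-1 * J)).
  apply: (@le_trans _ _ (C * \int[m]_x `|phi x * psi (iter n T x)|)).
    rewrite -RintegralZl//; apply: normr_Rintegral_le.
    - exact: integrable_decorrelation.
    - exact: integrableZ_EFin.
    - by move=> x; rewrite normrM ler_wpM2r.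
  apply: ler_wpM2l; first exact: ltW.
  by rewrite -J_iter; exact: Rintegral_normM_le.
have le2 : `|\int[m]_x h n x| <= C.
  rewrite -[leRHS](Rintegral1 m); apply: normr_Rintegral_le => //.
    exact: (@bounded_integrable _ _ _ _ C).
  by apply: (@bounded_integrable _ _ _ _ `|C|).
have le3 : `|\int[m]_x phi x * \int[m]_x psi x| <=
    2^-1 * (eta * I + eta^-1 * J).
  have hI : (\int[m]_x phi x) ^+ 2 <= I by exact: sqr_Rintegral_le.
  have hJ : (\int[m]_x psi x) ^+ 2 <= J by exact: sqr_Rintegral_le.
  move: hI hJ; rewrite normrM.
  rewrite -(real_normK (num_real (\int[m]_x phi x))).
  rewrite -(real_normK (num_real (\int[m]_x psi x))).
  move: `|\int[m]_x phi x| `|\int[m]_x psi x| => p q pI qJ.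
  apply: (le_trans (ler_mul_weighted_sqr p q eta0)).
  apply: ler_wpM2l => //; apply: lerD; apply: ler_wpM2l => //.
    exact: ltW.
  by rewrite invr_ge0 ltW.
apply: (le_trans (ler_normB _ _)).
have := lerD le1 (ler_pM (normr_ge0 _) (normr_ge0 _) le2 le3).
rewrite -normrM => /le_trans; apply.
by rewrite le_eqVlt; apply/orP; left; apply/eqP; field; exact: lt0r_neq0.
Qed.

(** For a fixed [Q], a large [eta] brings the second term below [e / 2]; then [delta] is taken small
    in terms of [eta] to do the same for the first. *)
Let small_weights (Q e : R) : 0 <= Q -> 0 < e ->
  exists2 eta, 0 < eta & exists2 delta, 0 < delta &
    forall q, q < delta -> C * (eta * q + eta^-1 * Q) <= e.
Proof.
(* Using [Q + 1] keeps [eta] positive when [Q] is [0]. *)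
move=> Q0 e0; pose eta := 2 * C * (Q + 1) / e.
have eta0 : 0 < eta by rewrite divr_gt0// !mulr_gt0// ltr_wpDl.
have Ceta0 : 0 < 2 * C * eta by rewrite mulr_gt0// mulr_gt0.
exists eta => //; exists (e / (2 * C * eta)).
  exact: divr_gt0.
move=> q; rewrite ltr_pdivlMr// => qe.
have : C * (eta^-1 * Q) <= e / 2.
  rewrite (_ : e / 2 = C * (eta^-1 * (Q + 1))); last first.
    rewrite /eta; field; rewrite !lt0r_neq0//; exact: ltr_wpDl.
  by rewrite ler_pM2l// ler_pM2l ?invr_gt0// lerDl.
rewrite mulrDr; nra.
Qed.

(** One function is approximated at a time: first [psi] against a simple function, then [phi]
    against the given [psi]. The function held fixed plays the part of [Q] in [small_weights]. *)
Lemma cvg_decorrelation phi psi :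
  (forall x, 0 <= phi x) -> (forall x, 0 <= psi x) -> sqint phi -> sqint psi ->
  decorr phi psi n @[n --> \oo] --> 0.
Proof.
move=> phi0 psi0 fi gi.
have int2_ge0 f : 0 <= \int[m]_x (f x ^+ 2).
  by apply: Rintegral_ge0 => x _; exact: sqr_ge0.
have psi_simple (s : {nnsfun X >-> R}) : sqint s ->
    decorr s psi n @[n --> \oo] --> 0.
  move=> si; apply: cvgr0_approx => e e0.
  have [eta eta0 [delta delta0 small]] := small_weights (int2_ge0 s) e0.
  have [t ti pt] := nnsfun_square_approx psi0 gi delta0.
  exists (decorr s t); first exact: cvg_decorrelation_simple.
  move=> n; have ei := square_integrableB gi ti.
  have -> : decorr s psi n - decorr s t n = decorr s (fun x => psi x - t x) n.
    have <- : (fun x => - 1 * t x + psi x) = fun x => psi x - t x.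
      by apply/funext => x; rewrite mulN1r addrC.
    by rewrite decorrelation_linearr// mulN1r addrC.
  (* The weight is inverted because here the small factor is the second one. *)
  have := @decorrelation_le eta^-1 _ _ n _ si ei.
  rewrite invrK invr_gt0 => /(_ eta0)/le_trans; apply.
  by rewrite addrC; exact: small.
apply: cvgr0_approx => e e0.
have [eta eta0 [delta delta0 small]] := small_weights (int2_ge0 psi) e0.
have [s si ps] := nnsfun_square_approx phi0 fi delta0.
exists (decorr s psi); first exact: psi_simple.
move=> n; have ei := square_integrableB fi si.
have -> : decorr phi psi n - decorr s psi n = decorr (fun x => phi x - s x) psi n.
  have <- : (fun x => - 1 * s x + phi x) = fun x => phi x - s x.
    by apply/funext => x; rewrite mulN1r addrC.
  by rewrite decorrelation_linearl// mulN1r addrC.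
by apply: (le_trans (decorrelation_le n eta0 ei gi)); exact: small.
Qed.

End asymptotic_independence_L2.

(** * Shifting normalized Birkhoff sums *)

Section distribution_tools.
Context d (X : measurableType d) (R : realType) (P : probability X R).

Lemma bounded_expectation (M : R) (phi : X -> R) :
  measurable_fun setT phi -> (forall x, `|phi x| <= M) ->
  'E_P[phi]%E = (\int[P]_x phi x)%:E.
Proof.
move=> mphi phiM; rewrite unlock /Rintegral fineK//.
exact: integrable_fin_num (bounded_integrable P mphi phiM).
Qed.

(** The tail sets decrease to the empty set, so continuity from above applies. *)
Lemma probability_tail_small (W : X -> R) (e : R) :
  measurable_fun setT W -> 0 < e ->
  exists2 N : nat, measurable [set x | N%:R < `|W x|] &
    fine (P [set x | N%:R < `|W x|]) < e.
Proof.
move=> mW e0.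
pose F (n : nat) := [set x | n%:R < `|W x|].
have mF n : measurable (F n).
  have mnW : measurable_fun setT (fun x => `|W x|) by exact: measurableT_comp.
  have -> : F n = (fun x => `|W x|) @^-1` `]n%:R, +oo[.
    by apply/seteqP; split=> x /=; rewrite in_itv/= andbT.
  by rewrite -[X in measurable X]setTI; exact: mnW.
have F0 : \bigcap_n F n = set0.
  apply/seteqP; split=> // x /(_ (Num.truncn `|W x|).+1 I).
  by rewrite /F/= ltNge ltW// truncnS_gt.
have : P (F n) @[n --> \oo] --> P set0.
  rewrite -F0; apply: nonincreasing_cvg_mu => //.
  - by rewrite ltey_eq fin_num_measure.
  - by rewrite F0.
  - move=> n p np; apply/subsetPset => x /=; apply: le_lt_trans.
    by rewrite ler_nat.
rewrite measure0 => /fine_cvgP[_].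
move=> /cvgr_lt/(_ _ e0)[N _ /(_ _ (leqnn N)) FN].
by exists N; [exact: mF|exact: FN].
Qed.

End distribution_tools.

(** Compactness of the segment makes [delta] uniform in [x]. Only [x] is confined to the segment;
    [y] may leave it. *)
Lemma uniform_continuity_itv (R : realType) (g : R -> R) (M e : R) :
  continuous g -> 0 < e ->
  exists2 delta, 0 < delta &
    forall x y, `|x| <= M -> `|x - y| < delta -> `|g x - g y| <= e.
Proof.
move=> cg e0.
have /compact_near_coveringP cov := @segment_compact R (- M) M.
have := cov R (nbhs 0^'+)
  (fun delta x => forall y, `|x - y| < delta -> `|g x - g y| <= e) _ _.
case.
  move=> x _.
  have e2 : 0 < e / 2 by rewrite divr_gt0.
  have /cvgrPdist_le/(_ _ e2)/nbhs_ballP[r /= r0 gr] := cg x.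
  have r2 : 0 < r / 2 by rewrite divr_gt0.
  (* Half radii put both [z] and [y] within [r] of [x], so [g z] and [g y] are compared through
     [g x]. *)
  exists (ball x (r / 2), [set t | t < r / 2]) => /=.
    by split; [exact: nbhsx_ballx|exact: nbhs_right_lt].
  - move=> [z t]/= [xz tr] y zy.
    have xz' : `|x - z| < r / 2 by exact: xz.
    have gz := gr z (lt_le_trans xz _).
    have gy : `|g x - g y| <= e / 2.
      apply: gr; rewrite /ball/= -(subrK z x) -addrA.
      rewrite (le_lt_trans (ler_normD _ _))// (splitr r).
      by rewrite ltrD// (lt_trans zy).
    rewrite -(subrK (g x) (g z)) -addrA (le_trans (ler_normD _ _))//.
    rewrite (splitr e) lerD// distrC gz//; lra.
move=> delta /= delta0 H.
exists (delta / 2); first by rewrite divr_gt0.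
move=> x y xM; apply: H.
- rewrite /ball/= sub0r normrN gtr0_norm ?divr_gt0//.
  by rewrite ltr_pdivrMr// ltr_pMr// ltr1n.
- by rewrite divr_gt0.
- by rewrite /= in_itv/= -ler_norml.
Qed.

Section birkhoff_shift.
Context d (X : measurableType d) (R : realType) (m : probability X R).
Variable T : {mfun X >-> X}.
Hypothesis Tp : measure_preserving m T.
Variables (f : {mfun X >-> R}) (B : R^nat).
Hypothesis B_infty : B n @[n --> \oo] --> +oo.

Local Notation Z_ := (normalized_birkhoff_sum T f B).

Lemma normalized_birkhoff_sum_shift n x :
  Z_ n (T x) - Z_ n x = (f (iter n T x) - f x) / B n.
Proof.
rewrite /normalized_birkhoff_sum -mulrBl; congr (_ / _).
rewrite /birkhoff_sum; elim: n => [|n IH].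
  by rewrite !big_nil !subrr.
by rewrite !big_nat_recr//= -iterSr/=; move: IH; lra.
Qed.

Variables (d' : measure_display) (Y : measurableType d') (Q : probability Y R).
Variable Z : {RV Q >-> R}.
Hypothesis f_cvg : cvg_in_distribution (P := fun=> m)
  (fun n => normalized_birkhoff_sum T f B n) Z.

Lemma cvg_in_distribution_Rintegral (M : R) (g : R -> R) :
  continuous g -> (forall x, `|g x| <= M) ->
  \int[m]_x g (Z_ n x) @[n --> \oo] --> \int[Q]_y g (Z y).
Proof.
move=> cg gM.
have mg := continuous_measurable_fun cg.
have bg : bounded_fun g.
  exists M; split=> [|y My x _]; first exact: num_real.
  exact: le_trans (gM x) (ltW My).
have := f_cvg cg bg.
rewrite (@bounded_expectation _ _ _ Q M); last 2 first.
- exact: measurableT_comp.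
- by move=> y; exact: gM.
move=> /fine_cvgP[_]; apply: cvg_trans; apply: near_eq_cvg.
by apply: nearW => n /=; rewrite unlock.
Qed.

(* Moving by one step changes [S_n f] by [f \o T^n - f], which is negligible
   compared with [B_n]; tightness of [S_n f / B_n] makes up for the possible
   lack of uniform continuity of [g]. *)
Lemma cvg_birkhoff_shift (C : R) (g : R -> R) : 0 < C ->
  continuous g -> (forall x, `|g x| <= C) ->
  \int[m]_x `|g (Z_ n (T x)) - g (Z_ n x)| @[n --> \oo] --> 0.
Proof.
move=> C0 cg gC.
have mg := continuous_measurable_fun cg.
have mZ n : measurable_fun setT (Z_ n) by exact: measurable_funPT.
apply/cvgr0Pnorm_lt => e e0.
(* Three error terms below [e1], weighted by [2 * C], total less than [3 / 8 * e]; with the [e / 4]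
   from uniform continuity this stays below [e]. *)
pose e1 := e / (16 * C).
have e10 : 0 < e1 by rewrite divr_gt0// mulr_gt0.
have [N mN QN] := probability_tail_small Q (@measurable_funPT _ _ _ _ Z) e10.
have [N' mN' mF] := probability_tail_small m (@measurable_funPT _ _ _ _ f) e10.
set E := [set x | N%:R < `|Z x|] in mN QN.
set F := [set x | N'%:R < `|f x|] in mN' mF.
(* A continuous substitute for the indicator of a tail, since convergence in distribution only tests
   continuous functions. It carries the tail bound of [Z] over to [Z_ n] for large [n]. *)
pose chi (x : R) : R := Num.min 1 (Num.max 0 (`|x| - N%:R)).
have cabs : continuous (fun x : R => `|x| - N%:R : R^o).
  by move=> x; apply: cvgB; [exact: norm_continuous|exact: cvg_cst].
have cchi : continuous chi.
  move=> x; have c1 (r : R) : {for x, continuous (fun=> r : R^o)} by exact: cvg_cst.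
  exact: (continuous_min (c1 1) (continuous_max (c1 0) (cabs x))).
have chi01 x : 0 <= chi x <= 1.
  by rewrite /chi le_min ler01 le_max lexx ge_min lexx.
have chi1 x : `|chi x| <= 1.
  by have /andP[? ?] := chi01 x; rewrite ger0_norm.
have chi_far x : N%:R + 1 < `|x| -> chi x = 1.
  move=> xN; rewrite /chi (max_idPr _) ?(min_idPl _)//; move: xN; lra.
have chi_near x : `|x| <= N%:R -> chi x = 0.
  by move=> xN; rewrite /chi (max_idPl _) ?subr_le0// (min_idPr _).
have mchi := continuous_measurable_fun cchi.
have Qchi : \int[Q]_y chi (Z y) < e1.
  apply: le_lt_trans QN; rewrite -Rintegral_indic//.
  apply: le_Rintegral => //.
  - by apply: (@bounded_integrable _ _ _ _ 1) => //; exact: measurableT_comp.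
  - exact/square_integrable_integrable/square_integrable_indic.
  - move=> y _; rewrite indicE; have [yE|yE] := boolP (y \in E).
      by have /andP[] := chi01 (Z y).
    rewrite chi_near// leNgt; apply/negP => NZ.
    by move/negP: yE; apply; exact/mem_set.
have chi_small : \forall n \near \oo, \int[m]_x chi (Z_ n x) < e1.
  exact: (cvgr_lt _ (cvg_in_distribution_Rintegral cchi chi1)).
have [delta delta0 gdelta] :=
  uniform_continuity_itv (N%:R + 1) cg (divr_gt0 e0 (ltr0Sn _ 3)).
(* Where [f] and [f \o T^n] are both at most [N'] in absolute value, the shift then moves [Z_ n] by
   less than [delta]. *)
have B_large : \forall n \near \oo, 2 * N'%:R / delta < B n.
  by move/cvgryPgt : B_infty; exact.
near=> n.
have chi_n : \int[m]_x chi (Z_ n x) < e1 by near: n.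
have Bn : 2 * N'%:R / delta < B n by near: n.
have Bn0 : 0 < B n.
  by apply: le_lt_trans Bn; rewrite divr_ge0 ?mulr_ge0// ltW.
have mT := measurable_fun_iter T.
have iF : m.-integrable setT (EFin \o \1_F).
  exact/square_integrable_integrable/square_integrable_indic.
have iFT : m.-integrable setT (EFin \o (fun x => \1_F (iter n T x))).
  exact: (measure_preserving_integrable (mT n) (measure_preserving_iter n Tp) iF).
have FT : \int[m]_x \1_F (iter n T x) = fine (m F).
  rewrite -Rintegral_indic//.
  exact: (measure_preserving_Rintegral (mT n) (measure_preserving_iter n Tp) iF).
have ichi : m.-integrable setT (EFin \o (fun x => chi (Z_ n x))).
  by apply: (@bounded_integrable _ _ _ _ 1) => //; exact: measurableT_comp.
have i3 := integrableD_EFin (integrableD_EFin ichi iF) iFT.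
have ie : m.-integrable setT (EFin \o (fun=> e / 4)).
  by apply: (@bounded_integrable _ _ _ _ `|e / 4|).
have igg : m.-integrable setT
    (EFin \o (fun x => `|g (Z_ n (T x)) - g (Z_ n x)|)).
  apply: (@bounded_integrable _ _ _ _ (C + C)).
    apply: measurableT_comp => //; apply: measurable_funB.
      apply: (measurableT_comp mg); apply: (measurableT_comp (mZ n)).
      exact: measurable_funPT.
    exact: measurableT_comp.
  by move=> x; rewrite normr_id (le_trans (ler_normB _ _))// lerD.
(* If [Z_ n x], [f x] or [f (iter n T x)] is large, the bracket is at least [1] and the trivial
   bound [2 * C] suffices; otherwise uniform continuity gives [e / 4]. *)
have pointwise x : `|g (Z_ n (T x)) - g (Z_ n x)| <=
    e / 4 + 2 * C * (chi (Z_ n x) + \1_F x + \1_F (iter n T x)).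
  have le2C : `|g (Z_ n (T x)) - g (Z_ n x)| <= 2 * C.
    by rewrite (le_trans (ler_normB _ _))// mulr_natl mulr2n lerD.
  have sum0 : 0 <= chi (Z_ n x) + \1_F x + \1_F (iter n T x).
    by rewrite !addr_ge0//; have /andP[] := chi01 (Z_ n x).
  have e4 : 0 < e / 4 by rewrite divr_gt0.
  have far : 1 <= chi (Z_ n x) + \1_F x + \1_F (iter n T x) ->
    `|g (Z_ n (T x)) - g (Z_ n x)| <=
    e / 4 + 2 * C * (chi (Z_ n x) + \1_F x + \1_F (iter n T x)).
    move=> ge1; apply: (le_trans le2C); nra.
  have c0 : 0 <= chi (Z_ n x) by have /andP[] := chi01 (Z_ n x).
  have i0 y : 0 <= \1_F y :> R by [].
  have i1 y : F y -> \1_F y = 1 :> R by move=> Fy; rewrite indicE mem_set.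
  have [Zfar|Znear] := ltP (N%:R + 1) `|Z_ n x|.
    by apply: far; rewrite chi_far//; have := i0 x; have := i0 (iter n T x); lra.
  have [Fx|Fx] := ltP N'%:R `|f x|.
    by apply: far; rewrite (i1 x)//; have := i0 (iter n T x); lra.
  have [Fn|Fn] := ltP N'%:R `|f (iter n T x)|.
    by apply: far; rewrite (i1 (iter n T x))//; have := i0 x; lra.
  rewrite distrC (le_trans (gdelta _ _ Znear _))//; last first.
    by rewrite lerDl mulr_ge0// mulr_ge0// ltW.
  rewrite distrC normalized_birkhoff_sum_shift normrM normfV (gtr0_norm Bn0).
  rewrite ltr_pdivrMr// (le_lt_trans (ler_normB _ _))//.
  rewrite ltr_pdivrMr// in Bn; rewrite [ltRHS]mulrC; apply: le_lt_trans Bn.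
  by rewrite mulr_natl mulr2n lerD.
rewrite ger0_norm; last exact: Rintegral_ge0.
apply: (@le_lt_trans _ _ (\int[m]_x (e / 4 + 2 * C *
    (chi (Z_ n x) + \1_F x + \1_F (iter n T x))))).
  apply: le_Rintegral => //; apply: integrableD_EFin => //.
  exact: integrableZ_EFin.
rewrite RintegralD//; last exact: integrableZ_EFin.
rewrite RintegralZl// RintegralD//; last exact: integrableD_EFin.
rewrite RintegralD// FT Rintegral_indic// Rintegral1.
have : 2 * C * (\int[m]_x chi (Z_ n x) + fine (m F) + fine (m F)) <
    2 * C * (e1 + e1 + e1).
  by rewrite ltr_pM2l ?mulr_gt0// !ltrD.
have -> : 2 * C * (e1 + e1 + e1) = 3 / 8 * e.
  by rewrite /e1; field; exact: lt0r_neq0.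
by lra.
Unshelve. all: by end_near.
Qed.

End birkhoff_shift.

(** * Change of density *)

Section density.
Context d (X : measurableType d) (R : realType).
Variables (m P : probability X R) (w : X -> R).
Hypothesis w0 : forall x, 0 <= w x.
Hypothesis iw : m.-integrable setT (EFin \o w).
Hypothesis PE : forall U, measurable U -> P U = (\int[m]_(x in U) (w x)%:E)%E.

Let mw : measurable_fun setT w.
Proof. exact: integrable_measurable iw. Qed.

Let density_nnsfun (s : {nnsfun X >-> R}) :
  (\int[P]_x (s x)%:E = \int[m]_x (s x * w x)%:E)%E.
Proof.
have [n [c [A [mA ->]]]] := nnsfun_sum_indic s.
have iP i : P.-integrable setT (EFin \o \1_(A i)).
  exact/square_integrable_integrable/square_integrable_indic.
have im i : m.-integrable setT (EFin \o (fun x => \1_(A i) x * w x)).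
  apply: (@integrable_bounded_mul _ _ _ _ 1) => // x.
  by rewrite indicE; case: (_ \in _); rewrite ?normr1 ?normr0.
have [iPs Ps] := Rintegral_sum (index_enum 'I_n)
  (fun i => integrableZ_EFin (c i) (iP i)).
have [ims ms] := Rintegral_sum (index_enum 'I_n)
  (fun i => integrableZ_EFin (c i) (im i)).
have -> : (fun x => ((\sum_(i < n) c i * \1_(A i) x) * w x)%:E) =
    EFin \o (fun x => \sum_(i < n) c i * (\1_(A i) x * w x)).
  apply/funext => x /=; congr (_%:E); rewrite mulr_suml.
  by apply: eq_bigr => i _; rewrite mulrA.
rewrite -(fineK (integrable_fin_num measurableT iPs)).
rewrite -(fineK (integrable_fin_num measurableT ims)).
congr (_%:E); rewrite [LHS]Ps [RHS]ms; apply: eq_bigr => i _.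
rewrite !RintegralZl// Rintegral_indic// PE//; congr (_ * fine _).
rewrite [LHS]integral_mkcond; apply: eq_integral => x _.
by rewrite patchE indicE; case: (_ \in _); rewrite ?mul1r ?mul0r.
Qed.

(** Monotone convergence on both sides reduces this to simple functions, where it follows from [PE]
    by linearity. *)
Lemma density_ge0_integral (f : X -> R) : measurable_fun setT f ->
  (forall x, 0 <= f x) ->
  (\int[P]_x (f x)%:E = \int[m]_x (f x * w x)%:E)%E.
Proof.
move=> mf f0.
have mEf : measurable_fun setT (EFin \o f) by exact/measurable_EFinP.
pose s n : {nnsfun X >-> R} := nnsfun_approx measurableT mEf n.
have ef0 x : setT x -> (0 <= (EFin \o f) x)%E by rewrite lee_fin.
have cvgs x : (s n x)%:E @[n --> \oo] --> (f x)%:E.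
  exact: (cvg_nnsfun_approx measurableT mEf ef0 (I : setT x)).
have nds x : {homo s ^~ x : p q / (p <= q)%N >-> p <= q}.
  by move=> p q pq; exact/lefP/nd_nnsfun_approx.
have lhs : (\int[P]_x (s n x)%:E @[n --> \oo] --> \int[P]_x (f x)%:E)%E.
  rewrite (_ : (\int[P]_x (f x)%:E)%E = (\int[P]_x limn (fun n => (s n x)%:E))%E).
    apply: cvg_monotone_convergence => //.
    - by move=> n; exact/measurable_EFinP.
    - by move=> n x _; rewrite lee_fin.
    - by move=> x _ p q pq; rewrite lee_fin nds.
  by apply: eq_integral => x _; apply/esym/cvg_lim.
have rhs : (\int[m]_x (s n x * w x)%:E @[n --> \oo] --> \int[m]_x (f x * w x)%:E)%E.
  rewrite (_ : (\int[m]_x (f x * w x)%:E)%E =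
      (\int[m]_x limn (fun n => (s n x * w x)%:E))%E).
    apply: cvg_monotone_convergence => //.
    - by move=> n; exact/measurable_EFinP/measurable_funM.
    - by move=> n x _; rewrite lee_fin mulr_ge0.
    - by move=> x _ p q pq; rewrite lee_fin ler_wpM2r// nds.
  apply: eq_integral => x _; rewrite EFinM; apply/esym/cvg_lim => //.
  under eq_fun do rewrite EFinM.
  by apply: cvgeZr => //; exact: cvgs.
rewrite (_ : (fun n => _) = fun n => \int[m]_x (s n x * w x)%:E)%E in lhs.
  exact: (cvg_unique _ lhs rhs).
by apply/funext => n; exact: density_nnsfun.
Qed.

(** Adding [C] makes [h] nonnegative; the constant cancels afterwards because [w] has integral
    [1]. *)
Lemma density_Rintegral (C : R) (h : X -> R) : measurable_fun setT h ->
  (forall x, `|h x| <= C) ->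
  \int[P]_x h x = \int[m]_x (h x * w x).
Proof.
move=> mh hC.
have int_w : \int[m]_x w x = 1.
  by rewrite /Rintegral -PE// probability_setT.
have hC0 x : 0 <= h x + C.
  by rewrite -lerBlDr sub0r lerNl (le_trans _ (hC x))// -normrN ler_norm.
have mhC : measurable_fun setT (fun x => h x + C) by exact: measurable_funD.
have ihP : P.-integrable setT (EFin \o h) by exact: (bounded_integrable P mh hC).
have icP : P.-integrable setT (EFin \o (fun=> C)).
  by apply: (@bounded_integrable _ _ _ _ `|C|).
have ihw : m.-integrable setT (EFin \o (fun x => h x * w x)).
  exact: integrable_bounded_mul hC iw.
have icw : m.-integrable setT (EFin \o (fun x => C * w x)).
  exact: integrableZ_EFin.
have := congr1 fine (density_ge0_integral mhC hC0).
rewrite -!/(Rintegral _ _ _) RintegralD// Rintegral1.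
under [in RHS]eq_Rintegral do rewrite mulrDl.
rewrite RintegralD// RintegralZl// int_w mulr1.
exact: addIr.
Qed.

End density.

(** * Convergence in distribution under the measures with density *)

Theorem theorem2p1 (R : realType) (d : measure_display) (X : measurableType d)
    (m : probability X R) (T : {mfun X >-> X})
    (T_preserving : measure_preserving m T)
    (T_ergodic : ergodic m T) (T_mixing : mixing m T)
    (f : {mfun X >-> R}) (B : R^nat) (B_infty : B n @[n --> \oo] --> +oo)
    (d' : measure_display) (Y : measurableType d') (Q : probability Y R)
    (Z : {RV Q >-> R})
    (f_cvg : cvg_in_distribution (P := fun=> m)
      (fun n => normalized_birkhoff_sum T f B n) Z)
    (phi1 phi2 : {mfun X >-> R})
    (phi1_ge0 : forall x, 0 <= phi1 x) (phi2_ge0 : forall x, 0 <= phi2 x)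
    (phi1_L2 : (phi1 : X -> R) \in Lfun m 2%:E)
    (phi2_L2 : (phi2 : X -> R) \in Lfun m 2%:E)
    (phi1_int : (\int[m]_x (phi1 x)%:E = 1)%E)
    (phi2_int : (\int[m]_x (phi2 x)%:E = 1)%E) :
  let mn n : {measure set X -> \bar R} :=
    density_measure m T phi1_ge0 phi2_ge0 n in
  (mn n setT @[n --> \oo] --> 1%E) /\
  (* [mnormalize (mn n) m] is [mn n / mn n setT], except at the finitely many
     [n] with [mn n setT = 0], where it is [m]. *)
  cvg_in_distribution (P := fun n => mnormalize (mn n) m)
    (fun n => normalized_birkhoff_sum T f B n) Z.
Proof.
move=> mn.
have mT := measurable_fun_iter T.
have s1 := square_integrable_Lfun phi1_L2.
have s2 := square_integrable_Lfun phi2_L2.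
pose w n x := phi1 x * phi2 (iter n T x).
have w0 n x : 0 <= w n x by exact: mulr_ge0.
have iw n : m.-integrable setT (EFin \o w n).
  apply: square_integrableM => //.
  exact: (measure_preserving_square_integrable (mT n)
    (measure_preserving_iter n T_preserving) s2).
pose c n := \int[m]_x w n x.
have mnE n : mn n setT = (c n)%:E.
  by rewrite /c /Rintegral fineK//; exact: (integrable_fin_num _ (iw n)).
have int1 : \int[m]_x phi1 x * \int[m]_x phi2 x = 1.
  by rewrite /Rintegral phi1_int phi2_int mulr1.
have decorrE (h : nat -> X -> R) n : decorrelation m T h phi1 phi2 n =
    \int[m]_x (h n x * w n x) - \int[m]_x h n x.
  by rewrite /decorrelation int1 mulr1.
(* The total mass is the case of the constant family [1], for which the shift condition holds
   trivially. *)
have cvg_c : c n @[n --> \oo] --> (1 : R).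
  have H : decorrelation m T (fun _ _ => 1 : R) phi1 phi2 n @[n --> \oo] --> 0.
    apply: (@cvg_decorrelation _ _ _ _ _ T_preserving T_mixing 1) => //.
    - by move=> n x; rewrite normr1.
    - have -> : (fun=> \int[m]_x `|1 - 1|) = cst 0 :> R^nat.
        apply/funext => n; under eq_Rintegral do rewrite subrr normr0.
        exact: Rintegral1.
      exact: cvg_cst.
  rewrite -[X in _ --> X]add0r.
  have -> : c = fun n => decorrelation m T (fun _ _ => 1 : R) phi1 phi2 n + 1.
    apply/funext => n; rewrite decorrE Rintegral1 subrK.
    by apply: eq_Rintegral => x _; rewrite mul1r.
  by apply: cvgD => //; exact: cvg_cst.
split.
  under eq_fun do rewrite mnE.
  by apply: cvg_EFin; [exact: nearW|exact: cvg_c].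
move=> g cg bg.
(* [bounded_fun] bounds [g] by every number above some [M], possibly negative; [|M| + 1] is such a
   number and is positive. *)
have [C C0 gC] : exists2 C, 0 < C & forall x, `|g x| <= C.
  have [M [_ HM]] := bg; exists (`|M| + 1); first by rewrite ltr_wpDl.
  by move=> x; apply: HM => //; rewrite (le_lt_trans (ler_norm M))// ltrDl.
have mg := continuous_measurable_fun cg.
pose h n x := g (normalized_birkhoff_sum T f B n x).
have mh n : measurable_fun setT (h n).
  by apply: (measurableT_comp mg); exact: measurable_funPT.
have hC n x : `|h n x| <= C by exact: gC.
have cvg_h : \int[m]_x h n x @[n --> \oo] --> \int[Q]_y g (Z y).
  exact: (cvg_in_distribution_Rintegral f_cvg cg gC).
have H : decorrelation m T h phi1 phi2 n @[n --> \oo] --> 0.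
  apply: (@cvg_decorrelation _ _ _ _ _ T_preserving T_mixing C) => //.
  exact: (cvg_birkhoff_shift T_preserving B_infty f_cvg C0 cg gC).
have cvg_hw : \int[m]_x (h n x * w n x) / c n @[n --> \oo] --> \int[Q]_y g (Z y).
  rewrite -[X in _ --> X]divr1; apply: cvgM; last by apply: cvgV.
  rewrite -[X in _ --> X]add0r.
  have -> : (fun n => \int[m]_x (h n x * w n x)) =
      fun n => decorrelation m T h phi1 phi2 n + \int[m]_x h n x.
    by apply/funext => n; rewrite decorrE subrK.
  exact: cvgD.
rewrite (@bounded_expectation _ _ _ Q C); last 2 first.
- exact: measurableT_comp.
- by move=> y; exact: gC.
(* The identity is claimed only for large [n]: where [c n = 0], [mnormalize] falls back on [m]. *)
suff near_E : \forall n \near \oo, ('E_(mnormalize (mn n) m)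
    [g \o normalized_birkhoff_sum T f B n])%E =
    (\int[m]_x (h n x * w n x) / c n)%:E.
  apply/fine_cvgP; split; first by apply: filterS near_E => n ->.
  apply: cvg_trans cvg_hw; apply: near_eq_cvg.
  by apply: filterS near_E => n /= ->.
have c_gt0 : \forall n \near \oo, 0 < c n by exact: (cvgr_gt _ cvg_c).
near=> n.
have cn0 : 0 < c n by near: n.
rewrite (@bounded_expectation _ _ _ _ C); [|exact: mh|exact: hC]; congr EFin.
(* The normalized measure has density [(c n)^-1 * w n] with respect to [m]. *)
rewrite (@density_Rintegral _ _ _ m _ (fun x => (c n)^-1 * w n x) _ _ _ C)//.
- rewrite mulrC -RintegralZl//; last exact: (integrable_bounded_mul (mh n) (hC n)).
  by apply: eq_Rintegral => x _; rewrite mulrCA.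
- by move=> x; rewrite mulr_ge0// invr_ge0 ltW.
- exact: integrableZ_EFin.
- move=> U mU; rewrite [LHS]/= /mnormalize mnE eqe gt_eqF//= muleC.
  rewrite -integralZl//; exact: integrableS (iw n).
- exact: mh.
- exact: hC.
Unshelve. all: by end_near.
Qed.
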